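(* Let $\mathcal{G}=\langle V,E,p\rangle$ be a bidding parity game and $v\in V$. For $i\in\{1,2\}$, if Player $i$'s initial budget $B^{init}_i$ satisfies $B^{init}_i>\textsc{Thresh}_i(v)$, then Player $i$ has a memoryless strategy from $v$ that is winning.
   Context: A bidding game is played on a finite directed graph $(V,E)$ (every vertex having an outgoing edge) by moving a token. Player 1 and Player 2 hold budgets $B_1,B_2\ge0$ with $B_1+B_2=1$. In each round both players simultaneously submit a bid, a real number in $[0,B_i]$; the higher bidder pays his bid to the other player and moves the token along an outgoing edge of the current vertex; ties are resolved by some fixed tie-breaking rule. A strategy maps each finite history (visited vertices together with winning bids and winners) to a legal bid and a successor vertex to move to upon winning. In a bidding parity game $\langle V,E,p\rangle$ with $p:V\to\{0,\dots,d\}$, an infinite play is won by Player 1 iff the maximal index visited infinitely often is odd, and by Player 2 otherwise. The threshold budget $\textsc{Thresh}:V\to[0,1]$ is such that if Player 1's budget at $v$ exceeds $\textsc{Thresh}(v)$ he can win, and if Player 2's budget exceeds $1-\textsc{Thresh}(v)$ he can win; write $\textsc{Thresh}_1(v)=\textsc{Thresh}(v)$ and $\textsc{Thresh}_2(v)=1-\textsc{Thresh}(v)$. A memoryless strategy at a vertex $v$ with initial budget $B$ is a pair $\langle u,f^B_v\rangle$ where $u$ is a successor of $v$ (the vertex moved to upon winning) and $f^B_v:[0,1]\to[0,1]$ maps the current budget to a bid, where $f^B_v$ is required to be simple, namely a polynomial or a selection among a constant number of polynomials; a memoryless strategy may depend on the initial vertex and initial budget, and a concatenation of memoryless strategies is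 also called memoryless. *)

(* Defs.v *)
From HB Require Import structures.
From mathcomp Require Import all_boot all_order all_algebra.
From mathcomp Require Import polyXY reals.

Set Implicit Arguments.
Unset Strict Implicit.
Unset Printing Implicit Defensive.

Import Order.TTheory GRing.Theory Num.Theory.
Local Open Scope ring_scope.

Inductive player := Player1 | Player2.

Definition opponent (i : player) : player :=
  match i with Player1 => Player2 | Player2 => Player1 end.

Record parity_game := ParityGame {
  vertex : finType;
  edge : rel vertex;
  edge_total : forall v, exists u, edge v u;
  max_index : nat;
  index_of : vertex -> 'I_max_index.+1
}.

(* [Round h i b u] extends [h] by a round won by player [i] with winning bid
   [b], after which the token is on [u]; the losing bid is not recorded. *)
Inductive history (R : realType) (G : parity_game) :=
  | Start of vertex G
  | Round of history R G & player & R & vertex G.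
Arguments Start {R G}.

(* Given Player 1's current budget, the history and the tied bid, the player
   who wins the tie. *)
Definition tie_rule (R : realType) (G : parity_game) : Type :=
  R -> history R G -> R -> player.

(* The bid, and the vertex to move to upon winning the bidding. *)
Definition strategy (R : realType) (G : parity_game) : Type :=
  history R G -> R * vertex G.

Definition budgets (R : realType) (B : player -> R) : Prop :=
  (forall i, 0 <= B i) /\ B Player1 + B Player2 = 1.

Section Bidding.
Variables (R : realType) (G : parity_game).
Implicit Types (B : player -> R) (h : history R G) (v : vertex G).

Definition current h : vertex G :=
  match h with Start v => v | Round _ _ _ u => u end.

(* The winner of a round pays his bid to the other player. *)
Fixpoint budget B (i : player) h : R :=
  match h with
  | Start _ => B i
  | Round h' w b _ =>
      match w, i with
      | Player1, Player1 | Player2, Player2 => budget B i h' - b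
      | Player1, Player2 | Player2, Player1 => budget B i h' + b
      end
  end.

Fixpoint history_from B v h : Prop :=
  match h with
  | Start u => u = v
  | Round h' w b u =>
      [/\ history_from B v h', edge (current h') u & 0 <= b <= budget B w h']
  end.

Definition legal B v (i : player) (s : strategy R G) : Prop :=
  forall h, history_from B v h ->
    0 <= (s h).1 <= budget B i h /\ edge (current h) (s h).2.

Definition round_winner (tie : tie_rule R G) B
    (s : player -> strategy R G) h : player :=
  let b1 := (s Player1 h).1 in
  let b2 := (s Player2 h).1 in
  if b2 < b1 then Player1
  else if b1 < b2 then Player2
  else tie (budget B Player1 h) h b1.

Fixpoint play (tie : tie_rule R G) B v (s : player -> strategy R G)
    (n : nat) : history R G :=
  match n with
  | 0%N => Start v
  | n'.+1 =>
      let h := play tie B v s n' in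
      let w := round_winner tie B s h in
      Round h w (s w h).1 (s w h).2
  end.

Definition infinitely_often (x : nat -> vertex G) (k : nat) : Prop :=
  forall N, exists2 n, (N <= n)%N & index_of (x n) = k :> nat.

Definition max_inf_index_odd (x : nat -> vertex G) : Prop :=
  exists k, [/\ infinitely_often x k,
                forall k', infinitely_often x k' -> (k' <= k)%N & odd k].

Definition wins (i : player) (x : nat -> vertex G) : Prop :=
  match i with
  | Player1 => max_inf_index_odd x
  | Player2 => ~ max_inf_index_odd x
  end.

Definition profile (i : player) (s t : strategy R G) : player -> strategy R G :=
  fun j => match i, j with
           | Player1, Player1 | Player2, Player2 => s
           | Player1, Player2 | Player2, Player1 => t
           end.

Definition winning (tie : tie_rule R G) B v (i : player) (s : strategy R G)
    : Prop :=
  legal B v i s /\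
  forall t, legal B v (opponent i) t ->
    wins i (fun n => current (play tie B v (profile i s t) n)).

Definition thresh_of (Thresh : vertex G -> R) (i : player) v : R :=
  match i with Player1 => Thresh v | Player2 => 1 - Thresh v end.

Definition is_threshold (tie : tie_rule R G) (Thresh : vertex G -> R) : Prop :=
  forall v, 0 <= Thresh v <= 1 /\
    forall i B, budgets B -> thresh_of Thresh i v < B i ->
      exists s, winning tie B v i s.

(* A family [f b : [0,1] -> [0,1]] of bid functions of the current budget,
   indexed by the initial budget [b]: each [f b] selects among [k] polynomials
   in the current budget by a case distinction on intervals ([k = 1] is the
   case of a polynomial).  The coefficients are themselves polynomials in [b],
   with the same [k] for all [b].  For a strategy started with one given
   initial budget this uniformity is no restriction, but concatenations reset
   [b] during the play: were the dependence on [b] arbitrary, resetting it in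
   each round would allow an arbitrary bid function of the current budget. *)
Definition simple_bids (f : R -> R -> R) : Prop :=
  exists (k : nat) (Q : 'I_k -> {poly {poly R}}) (I : R -> 'I_k -> interval R),
    forall b x, b \in `[0, 1] -> x \in `[0, 1] ->
      (exists j, x \in I b j) /\
      (forall j, x \in I b j -> f b x = (Q j).[x, b]).

(* A concatenation of memoryless strategies.  [pairs w b v] is the pair
   <u, f> used at [v] by the memoryless strategy with initial vertex [w] and
   initial budget [b].  This strategy is followed until the token is moved to a
   vertex of [stop w b]; from there on play continues with the memoryless
   strategy whose initial vertex and budget are the current ones.  With [stop]
   constantly [set0] this is a single memoryless strategy. *)
Record memoryless := Memoryless {
  pairs : vertex G -> R -> vertex G -> vertex G * (R -> R);
  stop : vertex G -> R -> {set vertex G};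
  pairs_edge : forall w b v, edge v (pairs w b v).1;
  pairs_range : forall w b v x, x \in `[0, 1] -> (pairs w b v).2 x \in `[0, 1];
  pairs_simple : forall w v, simple_bids (fun b => (pairs w b v).2)
}.

(* Initial vertex and initial budget of the memoryless strategy in force. *)
Fixpoint phase (m : memoryless) B (i : player) h : vertex G * R :=
  match h with
  | Start v => (v, B i)
  | Round h' _ _ u =>
      let: (w, b) := phase m B i h' in
      if u \in stop m w b then (u, budget B i h) else (w, b)
  end.

Definition strategy_of (m : memoryless) B (i : player) : strategy R G :=
  fun h => let: (w, b) := phase m B i h in
           let: (u, f) := pairs m w b (current h) in
           (f (budget B i h), u).

End Bidding.

(* Main.v *)
Require Import Defs.
From HB Require Import structures.
From mathcomp Require Import all_boot all_order all_algebra.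
From mathcomp Require Import polyXY reals.
From mathcomp Require Import boolp classical_sets lra.

Set Implicit Arguments.
Unset Strict Implicit.
Unset Printing Implicit Defensive.

Import Order.TTheory GRing.Theory Num.Theory.
Local Open Scope ring_scope.

(* Call a vertex recurrent if it lies in a bottom strongly connected component.
   Let T be 0 or 1 on the recurrent vertices, according to the parity of the
   largest index of their component, and elsewhere the mean of its least and
   largest values at the successors.  Player i wins above T_i by visiting
   infinitely often a recurrent vertex carrying the largest index of its
   component.  To this end he bids d(v) + c / 3^(r(v)+1), where d(v) is half the
   spread of T at the successors of v, r(v) is a distance to the vertices to be
   visited along successors of least T_i, and c > 0 is fixed by the surplus over
   T_i at the last such visit; upon winning he decreases r.  The surplus minus
   c (1 - 1 / 3^(r(v)+1)) then increases in every round by at least a constant,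
   whoever wins, so the next visit comes after boundedly many rounds.  Both
   players winning above T_i, any threshold function must agree with T. *)

(** * Plays, budgets and exclusive wins *)

Section Play.
Variables (R : realType) (G : parity_game).
Implicit Types (B : player -> R) (h : history R G) (v : vertex G).

Lemma budget_sum B h : budgets B -> budget B Player1 h + budget B Player2 h = 1.
Proof. by case=> _ sB; elim: h => [//|h IH [] b u /=]; lra. Qed.

Lemma budget_ge0 B v h i : budgets B -> history_from B v h -> 0 <= budget B i h.
Proof.
move=> [B0 _]; elim: h i => [u|h IH w b u] i /= => [_|]; first exact: B0.
case=> /IH h0 _ /andP[b0 bB]; have := h0 Player1; have := h0 Player2.
by case: w bB; case: i => /=; lra.
Qed.

Lemma budget_le1 B v h i : budgets B -> history_from B v h -> budget B i h <= 1.
Proof.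
move=> hB hh; have := budget_sum h hB.
have := budget_ge0 Player1 hB hh; have := budget_ge0 Player2 hB hh.
by case: i; lra.
Qed.

Lemma play_history tie B v (s : player -> strategy R G) n :
  (forall j, legal B v j (s j)) -> history_from B v (play tie B v s n).
Proof.
move=> ls; elim: n => [//|n IH /=].
by have [? ?] := ls (round_winner tie B s (play tie B v s n)) _ IH.
Qed.

Lemma profile_legal B v i s t :
  legal B v i s -> legal B v (opponent i) t ->
  forall j, legal B v j (profile i s t j).
Proof. by case: i => ls lt []. Qed.

(** A tie may go to either side, so a lost round only guarantees that the opponent bid at least as
    much; this weak inequality suffices for the surplus estimates. *)
Lemma round_winnerP tie B i s t h (w := round_winner tie B (profile i s t) h) :
  w = i \/ (w = opponent i /\ (s h).1 <= (t h).1).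
Proof.
rewrite {}/w /round_winner; case: i => /=; case: (ltgtP (s h).1) => _;
  by [left | right | case: (tie _ _ _); [left | right] |
      case: (tie _ _ _); [right | left]].
Qed.

Lemma play_step tie B v i s t n (h := play tie B v (profile i s t) n)
    (h' := play tie B v (profile i s t) n.+1) :
  h' = Round h i (s h).1 (s h).2 \/
  (h' = Round h (opponent i) (t h).1 (t h).2 /\ (s h).1 <= (t h).1).
Proof.
rewrite {}/h' /= -/h.
case: (round_winnerP tie B i s t h) => [->|[-> ?]]; [left|right];
  by rewrite {1 2}/profile; case: (i).
Qed.

(** Playing [s] against [t] yields a single play, on which the two winning conditions are
    complementary. *)
Lemma winning_exclusive tie B v i s t :
  winning tie B v i s -> winning tie B v (opponent i) t -> False.
Proof.
move=> [ls ws] [lt wt].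
have lo : legal B v (opponent (opponent i)) s by case: i ls {ws lt wt}.
have := wt s lo; have := ws t lt.
have -> : profile (opponent i) t s = profile i s t.
  by apply: funext => j; case: i {ls lt lo ws wt}; case: j.
by case: i {ls lt lo ws wt} => /=.
Qed.

End Play.

(** * Visiting a target set infinitely often by bidding *)

Section Buchi.
Variables (R : realType) (G : parity_game).
Variables (T d : vertex G -> R) (A : {set vertex G}).
Variables (tau : vertex G -> vertex G) (r : vertex G -> nat) (N : nat).

(** All that the bidding argument needs about the graph. Conditions on [tau] may assume [T v < 1],
    since a positive surplus with a budget of at most 1 forces it. *)
Record buchi_certificate : Prop := BuchiCertificate {
  cert_thresh_ge0 : forall v, 0 <= T v;
  cert_bid_ge0 : forall v, 0 <= d v;
  cert_edge : forall v, edge v (tau v);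
  cert_win : forall v, T v < 1 -> T (tau v) <= T v - d v;
  cert_lose : forall v u, edge v u -> T u <= T v + d v;
  cert_rank : forall v, T v < 1 -> tau v \in A \/ (r (tau v) < r v)%N;
  cert_rank_le : forall v, (r v <= N)%N }.
Hypothesis cert : buchi_certificate.

Definition weight (n : nat) : R := 3^-1 ^+ n.+1.

Lemma weight_gt0 n : 0 < weight n.
Proof. by rewrite exprn_gt0 // invr_gt0. Qed.

Lemma weight_le m n : (m <= n)%N -> weight n <= weight m.
Proof.
move=> mn; apply: ler_wiXn2l => //; first by rewrite invr_ge0.
by rewrite invf_le1 ?ler1n.
Qed.

(** A won round costs [c * weight n] of surplus; thanks to the ratio 3, the drop in rank returns at
    least twice that to the potential. *)
Lemma weight_lt m n : (m < n)%N -> 3 * weight n <= weight m.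
Proof.
move=> /weight_le; have -> : weight m.+1 = 3^-1 * weight m by rewrite /weight exprS.
lra.
Qed.

Lemma weight_le3 n : 3 * weight n <= 1.
Proof.
have := weight_le (leq0n n); rewrite {2}/weight expr1 => ?.
by lra.
Qed.

(* The square of the surplus [b - T w] is a polynomial that is nonnegative
   everywhere and at most the surplus when the latter lies in [0, 1]. *)
Definition target_bid (w : vertex G) (b : R) (v : vertex G) : R :=
  d v + (b - T w) ^+ 2 * weight (r v).

Lemma target_bid_ge0 w b v : 0 <= target_bid w b v.
Proof.
by rewrite addr_ge0 ?(cert_bid_ge0 cert) // mulr_ge0 ?sqr_ge0 // ltW ?weight_gt0.
Qed.

(** The cap by the current budget [x] keeps the bid legal after every history; under [inv] it is
    never active. *)
Let buchi_pairs (w : vertex G) (b : R) (v : vertex G) :=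
  (tau v, fun x => Num.min x (target_bid w b v)).

Lemma buchi_edge w b v : edge v (buchi_pairs w b v).1.
Proof. exact: cert_edge cert v. Qed.

Lemma buchi_range w b v x :
  x \in `[0, 1] -> (buchi_pairs w b v).2 x \in `[0, 1].
Proof.
rewrite !in_itv /= => /andP[x0 x1].
by rewrite le_min x0 target_bid_ge0 ge_min x1.
Qed.

Lemma buchi_simple w v : simple_bids (fun b => (buchi_pairs w b v).2).
Proof.
pose q : {poly R} := (d v)%:P + ('X - (T w)%:P) ^+ 2 * (weight (r v))%:P.
(* The outer variable ['X] is the current budget, while [q%:P] depends on the initial budget only.
   The two intervals share an endpoint, where both polynomials agree. *)
exists 2, (fun j => if j == ord0 then 'X else q%:P).
exists (fun b j => if j == ord0 then `]-oo, target_bid w b v]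
                   else `[target_bid w b v, +oo[) => b x _ _ /=.
have qE : q.[b] = target_bid w b v by rewrite /q !hornerE.
split=> [|j].
  case: (lerP x (target_bid w b v)) => [xl|/ltW xl].
    by exists ord0; rewrite eqxx in_itv.
  by exists (lift ord0 ord0); rewrite in_itv /= xl.
case: ifP => _; rewrite in_itv /= ?andbT => xl.
  by rewrite (min_idPl xl) !hornerE.
by rewrite (min_idPr xl) hornerC qE.
Qed.

Definition buchi_strategy : memoryless R G :=
  @Memoryless R G buchi_pairs (fun _ _ => A) buchi_edge buchi_range buchi_simple.

Variables (tie : tie_rule R G) (B : player -> R) (v0 : vertex G) (i : player).
Hypotheses (hB : budgets B) (hBi : T v0 < B i).

Let s := strategy_of buchi_strategy B i.

Lemma buchi_strategyE h :
  s h = let: (w, b) := phase buchi_strategy B i h in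
        (Num.min (budget B i h) (target_bid w b (current h)), tau (current h)).
Proof. by rewrite /s /strategy_of; case: phase. Qed.

Lemma buchi_legal : legal B v0 i s.
Proof.
move=> h hh; rewrite buchi_strategyE; case: phase => w b /=.
rewrite le_min (budget_ge0 i hB hh) target_bid_ge0 ge_min lexx /=.
by split=> //; exact: cert_edge cert _.
Qed.

Variable t : strategy R G.
Hypothesis lt : legal B v0 (opponent i) t.

Let H n := play tie B v0 (profile i s t) n.
Let V n := current (H n).
Let ph n := phase buchi_strategy B i (H n).
Let X n := budget B i (H n) - T (V n).
Let c n := ((ph n).2 - T (ph n).1) ^+ 2.
Let Phi n := X n - c n * (1 - weight (r (V n))).

Lemma play_from n : history_from B v0 (H n).
Proof. by apply: play_history; apply: profile_legal buchi_legal lt. Qed.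

Lemma play_edge n : edge (V n) (V n.+1).
Proof. by have [] := play_from n.+1. Qed.

(** Strong enough to make the next bid affordable, as every weight is at most 1/3; [weight N] bounds
    from below the weights of all ranks that occur. *)
Let inv n := 0 < c n /\ c n * weight N <= Phi n.

Lemma inv_surplus n : inv n -> c n * weight (r (V n)) <= X n.
Proof.
move=> [c0]; have w0 := weight_gt0 N; rewrite /Phi => hP.
have := weight_le3 (r (V n)); have := weight_gt0 (r (V n)); nra.
Qed.

(** At a reset [c] is the squared surplus, and [X ^+ 2 <= X] on [0, 1] leaves a potential of at
    least [c * weight (r v)]. *)
Lemma phase_start n : 0 < X n -> ph n = (V n, budget B i (H n)) -> inv n.
Proof.
move=> X0 e; rewrite /inv.
have cE : c n = X n ^+ 2 by rewrite /c e.
have X1 : X n <= 1.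
  have := budget_le1 i hB (play_from n); have := cert_thresh_ge0 cert (V n).
  by rewrite /X; lra.
have := weight_le (cert_rank_le cert (V n)); have := weight_gt0 N.
rewrite /Phi cE; split; first by rewrite exprn_gt0.
have : X n ^+ 2 <= X n by rewrite expr2 ger_pMl.
by have := sqr_ge0 (X n); nra.
Qed.

Lemma inv0 : inv 0.
Proof. by apply: phase_start => //; rewrite /X /= subr_gt0. Qed.

Lemma phaseS n :
  ph n.+1 = if V n.+1 \in A then (V n.+1, budget B i (H n.+1)) else ph n.
Proof. by rewrite /ph /V /H /= -/(H n); case: (phase _ _ _ (H n)). Qed.

(** The part [d v] of the bid is offset by the change of [T]: a winner sees [T] fall by at least
    [d v], a loser sees it rise by at most [d v]. Only the extra term of the bid remains. *)
Lemma surplus_step n : inv n ->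
  (V n.+1 = tau (V n) /\ X n - c n * weight (r (V n)) <= X n.+1) \/
  X n + c n * weight (r (V n)) <= X n.+1.
Proof.
move=> iv; have Xc := inv_surplus iv.
have X0 : 0 < X n.
  by apply: lt_le_trans Xc; rewrite mulr_gt0 ?weight_gt0 //; case: iv.
have T1 : T (V n) < 1.
  by have := budget_le1 i hB (play_from n); move: X0; rewrite /X; lra.
have hw := cert_win cert T1.
have t0 := cert_thresh_ge0 cert (tau (V n)).
have sE : s (H n) = (d (V n) + c n * weight (r (V n)), tau (V n)).
  rewrite buchi_strategyE /c /ph -/(V n).
  case E: (phase _ _ _ _) => [w b]; rewrite /target_bid; congr pair.
  (* The surplus covers the extra term, and [d v <= T v] because [T (tau v)] is nonnegative. *)
  apply/min_idPr; move: Xc; rewrite /X /c /ph E /=; lra.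
have := play_edge n.
have : H n.+1 = Round (H n) i (s (H n)).1 (s (H n)).2 \/
    (H n.+1 = Round (H n) (opponent i) (t (H n)).1 (t (H n)).2 /\
      (s (H n)).1 <= (t (H n)).1) := play_step tie B v0 i s t n.
rewrite sE /=.
rewrite /X /V => -[->|[-> le_st]] /=.
  by move=> _; left; split=> //; case: (i); rewrite -/(V n); lra.
move=> /(cert_lose cert) hl; right; move: hl le_st.
by rewrite -/(V n); case: (i) => /=; lra.
Qed.

Lemma surplus_gt0 n : inv n -> 0 < X n.
Proof.
move=> iv; apply: lt_le_trans (inv_surplus iv).
by rewrite mulr_gt0 ?weight_gt0 //; case: iv.
Qed.

Lemma thresh_lt1 n : inv n -> T (V n) < 1.
Proof.
move=> /surplus_gt0; rewrite /X.
by have := budget_le1 i hB (play_from n); lra.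
Qed.

(** After a loss the rank may rise, but the gain in surplus cancels the old weight term and the new
    one, at least [c * weight N], remains. After a win the rank falls and [weight_lt] applies. *)
Lemma potential_step n : inv n -> V n.+1 \notin A ->
  c n.+1 = c n /\ Phi n + c n * weight N <= Phi n.+1.
Proof.
move=> iv nA; have cE : c n.+1 = c n by rewrite /c phaseS (negbTE nA).
split=> //; rewrite /Phi cE; have [c0 _] := iv.
have h1 := weight_le (cert_rank_le cert (V n)).
have h2 := weight_le (cert_rank_le cert (V n.+1)).
have [[e hX]|hX] := surplus_step iv; last by nra.
have [|lt_r] := cert_rank cert (thresh_lt1 iv); first by rewrite -e (negbTE nA).
by have := weight_lt lt_r; rewrite -e; nra.
Qed.

Lemma invS n : inv n -> inv n.+1.
Proof.
move=> iv; have [c0 hP] := iv; have w0 := weight_gt0 N.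
have [inA|nA] := boolP (V n.+1 \in A); last first.
  have [cE hP'] := potential_step iv nA; rewrite /inv cE; split=> //; nra.
apply: phase_start; last by rewrite phaseS inA.
(* A reset needs only a positive surplus; even a win leaves
   [Phi n + c n * (1 - 2 * weight (r (V n)))]. *)
have := weight_le3 (r (V n)); have := weight_gt0 (r (V n)).
move: hP; rewrite /Phi => hP g0 g3.
by have [[_ hX]|hX] := surplus_step iv; nra.
Qed.

Lemma inv_all n : inv n.
Proof. by elim: n => [|n /invS//]; exact: inv0. Qed.

Lemma buchi_visits n0 : exists2 n, (n0 <= n)%N & V n \in A.
Proof.
apply: contrapT => hn.
have nA n : (n0 <= n)%N -> V n \notin A.
  by move=> n0n; apply/negP => inA; apply: hn; exists n.
have [c0 hP0] := inv_all n0; have w0 := weight_gt0 N.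
have grow k : c (n0 + k) = c n0 /\ (c n0 * weight N) *+ k <= Phi (n0 + k).
  elim: k => [|k [cE IH]]; first by rewrite addn0 mulr0n; split=> //; nra.
  have := potential_step (inv_all (n0 + k)); rewrite -addnS.
  case; first by apply: nA; rewrite leq_addr.
  by rewrite cE => -> h; split=> //; rewrite mulrSr; lra.
have e0 : 0 < c n0 * weight N by rewrite mulr_gt0.
(* After this many rounds without a visit [Phi] would exceed 1, although it is at most [X], hence at
   most 1. *)
have [_] := grow (Num.bound (1 / (c n0 * weight N))).
set k := Num.bound _; have : 1 / (c n0 * weight N) < k%:R.
  by apply: le_lt_trans (archi_boundP _); rewrite // divr_ge0 // ltW.
rewrite ltr_pdivrMr // mulr_natl => h1 h2.
have [c1 _] := inv_all (n0 + k).
have := weight_le3 (r (V (n0 + k))).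
have := budget_le1 i hB (play_from (n0 + k)).
have := cert_thresh_ge0 cert (V (n0 + k)).
have := weight_gt0 (r (V (n0 + k))).
by move: h2; rewrite /Phi /X => h2 *; nra.
Qed.

End Buchi.

(** * Bottom strongly connected components *)

Section Recurrence.
Variable G : parity_game.
Implicit Types (u v : vertex G) (i : player).

Definition recurrent v :=
  [forall u, connect (@edge G) v u ==> connect (@edge G) u v].

Definition top_index v : nat := \max_(u | connect (@edge G) v u) index_of u.

Lemma leq_top_index v u : connect (@edge G) v u -> (index_of u <= top_index v)%N.
Proof. by move=> vu; rewrite /top_index (bigD1 u) //= leq_maxl. Qed.

Lemma top_index_attained v :
  exists2 u, connect (@edge G) v u & index_of u = top_index v :> nat.
Proof.
have [|u vu e] := @eq_bigmax_cond _ (connect (@edge G) v) (fun u => index_of u : nat).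
  by apply/card_gt0P; exists v; exact: connect0.
by exists u.
Qed.

Lemma top_index_le v u :
  connect (@edge G) v u -> (top_index u <= top_index v)%N.
Proof.
by have [y uy <-] := top_index_attained u => vu; exact/leq_top_index/connect_trans/uy.
Qed.

Lemma recurrent_connect v u : recurrent v -> connect (@edge G) v u ->
  recurrent u /\ top_index u = top_index v.
Proof.
move=> /forallP rv vu; have uv := implyP (rv u) vu; split; last first.
  by apply/eqP; rewrite eqn_leq !top_index_le.
apply/forallP => y; apply/implyP => uy; apply: (connect_trans _ vu).
exact: implyP (rv y) (connect_trans vu uy).
Qed.

(** Among the reachable vertices take one that reaches the fewest: whatever it reaches has the same
    reachable set, hence leads back. *)
Lemma connect_recurrent v : exists2 u, connect (@edge G) v u & recurrent u.
Proof.
pose reach u := [set y | connect (@edge G) u y].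
have [u vu umin] := arg_minnP (fun u => #|reach u|) (connect0 (@edge G) v).
exists u => //; apply/forallP => y; apply/implyP => uy.
have sub : reach y \subset reach u.
  by apply/fintype.subsetP => z; rewrite !inE; exact: connect_trans.
have /eqP e : reach y == reach u.
  by rewrite eqEcard sub umin // (connect_trans vu uy).
have : u \in reach y by rewrite e inE connect0.
by rewrite inE.
Qed.

Definition favours i (k : nat) : bool :=
  match i with Player1 => odd k | Player2 => ~~ odd k end.

Definition target i : {set vertex G} :=
  [set v | [&& recurrent v, index_of v == top_index v :> nat
             & favours i (top_index v)]].

Lemma recurrent_target i v : recurrent v -> favours i (top_index v) ->
  exists2 u, connect (@edge G) v u & u \in target i.
Proof.
move=> rv fv; have [u vu e] := top_index_attained v; exists u => //.
by have [ru tu] := recurrent_connect rv vu; rewrite inE ru tu e eqxx.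
Qed.

(** From the first visit on, [top_index] is constant along the play: it bounds all later indices and
    is attained at every visit. *)
Lemma target_wins i (x : nat -> vertex G) :
  (forall n, edge (x n) (x n.+1)) ->
  (forall n0, exists2 n, (n0 <= n)%N & x n \in target i) -> wins i x.
Proof.
move=> xe xt; have [n0 _] := xt 0; rewrite inE => /and3P[r0 _ f0].
have conn n : (n0 <= n)%N -> connect (@edge G) (x n0) (x n).
  elim: n => [|n IH]; first by rewrite leqn0 => /eqP->.
  rewrite leq_eqVlt => /orP[/eqP->//|/IH c].
  exact: connect_trans c (connect1 (xe n)).
have iot : infinitely_often x (top_index (x n0)).
  move=> n1; have [n ln] := xt (maxn n0 n1); move: ln.
  rewrite geq_max inE => /andP[ln0 ln1] /and3P[_ /eqP e _].
  by exists n; rewrite // e; have [] := recurrent_connect r0 (conn _ ln0).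
have ub k : infinitely_often x k -> (k <= top_index (x n0))%N.
  by move=> /(_ n0)[n /conn c <-]; exact: leq_top_index.
case: i f0 {xt} => /= f0; first by exists (top_index (x n0)).
move=> [k [/ub le_k /(_ _ iot) ge_k ok]]; move: f0.
have -> : top_index (x n0) = k by apply/eqP; rewrite eqn_leq ge_k.
by rewrite ok.
Qed.

End Recurrence.

(** * The fixed point of the averaging operator *)

Section Richman.
Variables (R : realType) (G : parity_game).
Implicit Types (u v : vertex G) (f g : vertex G -> R).

Let succ v := xchoose (edge_total v).
Let lo f v := [arg min_(u < succ v | edge v u) f u]%O.
Let hi f v := [arg max_(u > succ v | edge v u) f u]%O.

Let loP f v : edge v (lo f v) /\ forall u, edge v u -> f (lo f v) <= f u.
Proof.
by rewrite /lo; case: arg_minP => //; exact: xchooseP.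
Qed.

Let hiP f v : edge v (hi f v) /\ forall u, edge v u -> f u <= f (hi f v).
Proof.
by rewrite /hi; case: arg_maxP => //; exact: xchooseP.
Qed.

Definition average f v : R :=
  if recurrent v then (~~ odd (top_index v))%:R
  else (f (lo f v) + f (hi f v)) / 2.

Lemma average_mono f g : (forall v, f v <= g v) ->
  forall v, average f v <= average g v.
Proof.
move=> fg v; rewrite /average; case: ifP => // _.
have [_ lf] := loP f v; have [eg _] := loP g v.
have [ef _] := hiP f v; have [_ hg] := hiP g v.
have := le_trans (lf _ eg) (fg _); have := le_trans (fg _) (hg _ ef).
by lra.
Qed.

Lemma average_itv f : (forall v, 0 <= f v <= 1) ->
  forall v, 0 <= average f v <= 1.
Proof.
move=> f01 v; rewrite /average; case: ifP => _; first by case: odd; rewrite /= ?lexx ?ler01.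
by have := f01 (lo f v); have := f01 (hi f v); lra.
Qed.

Let post f := (forall v, 0 <= f v <= 1) /\ forall v, f v <= average f v.

(** As in Knaster-Tarski, the pointwise supremum of the post-fixed points of the monotone [average]
    is its greatest fixed point with values in [0, 1]. *)
Definition richman v : R := sup [set f v | f in post]%classic.

Let post0 : post (fun=> 0).
Proof.
split=> v; first by rewrite lexx ler01.
by have /andP[] := @average_itv (fun=> 0) (fun _ => ltac:(by rewrite lexx ler01)) v.
Qed.

Let richman_ub f v : post f -> f v <= richman v.
Proof.
move=> pf; apply: ub_le_sup; last by exists f.
by exists 1 => _ [g [g01 _] <-]; have /andP[] := g01 v.
Qed.

Let richman_lub v x : (forall f, post f -> f v <= x) -> richman v <= x.
Proof.
move=> h; apply: ge_sup; last by move=> _ [f pf <-]; exact: h.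
by exists 0, (fun=> 0).
Qed.

Lemma richman_itv v : 0 <= richman v <= 1.
Proof.
apply/andP; split; first exact: richman_ub post0.
by apply: richman_lub => f [f01 _]; have /andP[] := f01 v.
Qed.

Lemma richman_average v : richman v = average richman v.
Proof.
have le u : richman u <= average richman u.
  apply: richman_lub => f pf; apply: le_trans (pf.2 u) _.
  by apply: average_mono => y; exact: richman_ub.
apply/eqP; rewrite eq_le le /=; apply: (@richman_ub (average richman)).
by split; [exact/average_itv/richman_itv|exact: average_mono].
Qed.

Lemma richman_recurrent v :
  recurrent v -> richman v = (~~ odd (top_index v))%:R.
Proof. by move=> rv; rewrite richman_average /average rv. Qed.

Lemma richman_neighbours v : exists a b,
  [/\ edge v a, edge v b,
      forall u, edge v u -> richman a <= richman u <= richman b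
    & richman v = (richman a + richman b) / 2].
Proof.
have [ea la] := loP richman v; have [eb lb] := hiP richman v.
exists (lo richman v), (hi richman v); split=> // [u vu|].
  by rewrite la ?lb.
have [rv|rv] := boolP (recurrent v); last first.
  by rewrite {1}richman_average /average (negbTE rv).
(* Here [average] prescribes a constant; it is still the mean, since all successors share the
   component and its value. *)
have [ra ta] := recurrent_connect rv (connect1 ea).
have [rb tb] := recurrent_connect rv (connect1 eb).
by rewrite !richman_recurrent // ta tb; lra.
Qed.

End Richman.

(** * Ranks along descending edges *)

Section Certificate.
Variables (R : realType) (G : parity_game) (i : player).
Implicit Types u v : vertex G.

Let T : vertex G -> R := thresh_of (@richman R G) i.

Lemma thresh_neighbours v : exists a b,
  [/\ edge v a, edge v b, forall u, edge v u -> T a <= T u <= T b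
    & T v = (T a + T b) / 2].
Proof.
have [a [b [ea eb ab e]]] := richman_neighbours R v.
rewrite /T; case: i => /=; first by exists a, b.
exists b, a; split=> // [u /ab|]; last rewrite e; lra.
Qed.

Lemma thresh_ge0 v : 0 <= T v.
Proof. by have := @richman_itv R G v; rewrite /T; case: i => /=; lra. Qed.

Lemma thresh_recurrent v : recurrent v -> T v < 1 ->
  T v = 0 /\ favours i (top_index v).
Proof.
move=> rv; rewrite /T; case: i => /=; rewrite richman_recurrent //;
  by case: odd => /=; lra.
Qed.

Variable d : vertex G -> R.
Hypothesis dP : forall v, [/\ 0 <= d v,
  exists2 a, edge v a & T a <= T v - d v
  & forall u, edge v u -> T u <= T v + d v].

Let descent : rel (vertex G) := [rel v u | edge v u && (T u <= T v - d v)].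

Lemma descent_le v u : connect descent v u -> T u <= T v.
Proof.
move=> /connectP[p pp ->]; elim: p v pp => [//|y p IH] v /= /andP[/andP[_ h] /IH].
by have [] := dP v; lra.
Qed.

(* Where [T] is minimal among the vertices reachable by descending edges, the
   averaging property forces all successors to have the same value, so the
   descending edges from there on are all edges and lead to a recurrent
   vertex. *)
Lemma descent_target v : T v < 1 ->
  exists2 u, connect descent v u & u \in target G i.
Proof.
move=> Tv.
case: (arg_minP T (connect0 descent v)) => m vm mmin.
have Tm : T m < 1 by apply: le_lt_trans (descent_le vm) Tv.
have flat z : connect (@edge G) m z -> connect descent v z /\ T z = T m.
  move=> /connectP[p pp ->]; elim/last_ind: p pp => [//|p y IH].
  rewrite rcons_path last_rcons => /andP[/IH[c e] ey].
  set z' := last m p in c e ey.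
  have [d0 [a ea la] up] := dP z'.
  have va : connect descent v a.
    by apply: connect_trans c (connect1 _); rewrite /descent /= ea.
  have := mmin _ va; have := up _ ey => h1 h2.
  have cy : connect descent v y.
    by apply: connect_trans c (connect1 _); rewrite /descent /= ey; lra.
  by split=> //; have := mmin _ cy; lra.
have [z mz rz] := connect_recurrent m.
have [_ fz] : T z = 0 /\ favours i (top_index z).
  by apply: thresh_recurrent => //; have [_ ->] := flat _ mz.
have [u zu ut] := recurrent_target rz fz.
by exists u => //; have [] := flat u (connect_trans mz zu).
Qed.

(** The descending path has length exactly [n]; minimality is imposed only when ranks are chosen. *)
Fixpoint near n v : bool :=
  if n is n'.+1 then [exists u, descent v u && near n' u] else v \in target G i.

Lemma connect_near v u : connect descent v u -> u \in target G i ->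
  exists n, near n v.
Proof.
move=> /connectP[p pp ->] up; exists (size p).
elim: p v pp up => [//|y p IH] v /= /andP[vy pp] up.
by apply/existsP; exists y; rewrite vy IH.
Qed.

Lemma rank_exists : exists (tau : vertex G -> vertex G) (r : vertex G -> nat) N,
  buchi_certificate T d (target G i) tau r N.
Proof.
have Dn v : exists k, T v < 1 -> near k v /\ forall m, near m v -> (k <= m)%N.
  have [Tv|_] := boolP (T v < 1); last by exists 0.
  have [u vu ut] := descent_target Tv.
  by case: (ex_minnP (connect_near vu ut)) => k; exists k.
have [r0 r0P] := fin_all_exists Dn.
(* Target vertices get a rank above all others, so that a move out of the target also decreases the
   rank. *)
pose N := \max_v r0 v; pose r v := if v \in target G i then N.+1 else r0 v.
have r0N v : (r0 v <= N)%N by exact: leq_bigmax.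
have tauP v : exists u, edge v u /\ (T v < 1 ->
    T u <= T v - d v /\ (u \in target G i \/ (r u < r v)%N)).
  have [d0 [a ea la] _] := dP v.
  have [Tv|_] := boolP (T v < 1); last by exists a.
  have [vt|vt] := boolP (v \in target G i).
    exists a; split=> // _; split=> //.
    have [|at_] := boolP (a \in target G i); [by left|right].
    by rewrite /r vt (negbTE at_) ltnS.
  have [nv _] := r0P v Tv; case E: (r0 v) nv => [|k] /=; first by rewrite (negbTE vt).
  move=> /existsP[u /andP[/andP[vu ud] nu]]; exists u; split=> // _; split=> //.
  have [|ut] := boolP (u \in target G i); [by left|right].
  rewrite /r (negbTE vt) (negbTE ut) E ltnS; apply: (r0P u _).2 => //.
  by apply: le_lt_trans Tv; lra.
have [tau tP] := fin_all_exists tauP; exists tau, r, N.+1; split.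
- exact: thresh_ge0.
- by move=> v; have [] := dP v.
- by move=> v; have [] := tP v.
- by move=> v Tv; have [_ /(_ Tv)[]] := tP v.
- by move=> v u; have [_ _] := dP v; exact.
- by move=> v Tv; have [_ /(_ Tv)[]] := tP v.
- by move=> v; rewrite /r; case: ifP => // _; apply: leqW.
Qed.

End Certificate.

(** * Memoryless strategies and comparison of thresholds *)

Lemma richman_memoryless (R : realType) (G : parity_game) (i : player) :
  exists m : memoryless R G, forall (tie : tie_rule R G) B v,
    budgets B -> thresh_of (@richman R G) i v < B i ->
    winning tie B v i (strategy_of m B i).
Proof.
pose T := thresh_of (@richman R G) i.
have dE v : exists d : R, [/\ 0 <= d,
    exists2 a, edge v a & T a <= T v - d
    & forall u, edge v u -> T u <= T v + d].
  have [a [b [ea eb ab]]] := thresh_neighbours R i v.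
  rewrite -/T in ab *; have := ab _ ea; exists ((T b - T a) / 2).
  by split; [lra|exists a => //; lra|move=> u /ab; lra].
have [d dP] := fin_all_exists dE.
have [tau [r [N cert]]] := rank_exists dP.
exists (buchi_strategy cert) => tie B v hB hBi; split.
  exact: buchi_legal.
move=> t lt; apply: target_wins => [n|n0].
  exact: (play_edge cert tie hB lt).
exact: (buchi_visits cert tie hB hBi lt).
Qed.

Theorem theorem10 (R : realType) (G : parity_game) (tie : tie_rule R G)
    (Thresh : vertex G -> R) (hThresh : is_threshold tie Thresh)
    (v : vertex G) (i : player) (B : player -> R) (hB : budgets B)
    (hBi : thresh_of Thresh i v < B i) :
  exists m : memoryless R G, winning tie B v i (strategy_of m B i).
Proof.
have [m hm] := richman_memoryless R G i; exists m; apply: hm => //.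
(* Otherwise both players would win with the midpoint [x] as budget of Player [i]: that player by
   [hThresh], the opponent because [x] lies strictly below the [richman] threshold. *)
rewrite ltNge; apply/negP => le_B.
have [T01 hT] := hThresh v.
pose x := (thresh_of Thresh i v + B i) / 2.
pose B' j : R := match i, j with
                 | Player1, Player1 | Player2, Player2 => x
                 | _, _ => 1 - x
                 end.
have [B0 B1] := hB.
have T0 : 0 <= thresh_of Thresh i v by case: (i) => /=; lra.
have Bi1 : B i <= 1 by have := B0 Player1; have := B0 Player2; case: (i); lra.
have hB' : budgets B'.
  by rewrite /B' /x; split=> [j|]; [case: (i) (j) T0 Bi1 hBi => [] []|case: (i)] => /=; lra.
have Bi' : B' i = x by rewrite /B'; case: (i).
have [s ws] : exists s, winning tie B' v i s.
  by apply: hT; rewrite // Bi' /x; lra.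
have [m' hm'] := richman_memoryless R G (opponent i).
apply: winning_exclusive ws (hm' tie B' v hB' _).
by move: le_B hBi; rewrite /B' /x; case: (i) => /=; lra.
Qed.
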